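(* Let $\mathcal{G}=(\mathcal{V},\mathcal{E})$, $\mathcal{V}=\{1,\dots,N\}$, be a connected graph containing a Hamiltonian cycle $1\to 2\to\cdots\to N\to 1$. Let $f_1,\dots,f_N:\mathbb{R}^p\to\mathbb{R}$ be differentiable functions such that, for some $L>0$, $\|\nabla f_i(u)-\nabla f_i(v)\|\le L\|u-v\|$ for all $u,v\in\mathbb{R}^p$ and all $i$, and such that $F(\boldsymbol{x})=\sum_{i=1}^N f_i(x_i)$, $\boldsymbol{x}=(x_1,\dots,x_N)\in\mathbb{R}^{pN}$, is bounded from below and coercive over $\boldsymbol{x}$. Assume $$\rho>L,\qquad \gamma_{i_k}^k>\max\left\{\frac{2\rho^2+4\rho+1}{\rho-L},\;2(\rho+2)N\right\},\quad k=0,1,\dots$$ Then the iterates $(\boldsymbol{x}^k,\boldsymbol{y}^k,z^k)_{k\ge 0}$ generated by PI-ADMM1 have limit points, and these limit points satisfy the KKT conditions of the problem $$\min_{\boldsymbol{x},z}\ \sum_{i=1}^N f_i(x_i)\quad\text{s.t.}\quad z-x_i=\boldsymbol{0},\ i=1,\dots,N.$$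
   Context: PI-ADMM1: let $\rho>0$ be a parameter and $i_k=(k \bmod N)+1$ the agent activated at iteration $k$. Initialization: $z^0=\boldsymbol{0}$, and for each $i\in\mathcal{V}$, $x_i^0\in\mathbb{R}^p$ is arbitrary (randomly generated) and $y_i^0=\rho x_i^0$, so that $x_i^0-y_i^0/\rho=\boldsymbol{0}$. At iteration $k=0,1,2,\dots$ a scalar $\gamma_{i_k}^k>0$ is generated, $\tilde\rho_{i_k}^k=\rho\,\gamma_{i_k}^k$, and - $x_{i_k}^{k+1}=\arg\min_{x\in\mathbb{R}^p}\ f_{i_k}(x)+\frac{\tilde\rho_{i_k}^k}{2}\left\|z^k-x+\frac{y_{i_k}^k}{\tilde\rho_{i_k}^k}\right\|^2$, and $x_i^{k+1}=x_i^k$ for $i\ne i_k$; - $y_{i_k}^{k+1}=y_{i_k}^k+\tilde\rho_{i_k}^k\,(z^k-x_{i_k}^{k+1})$, and $y_i^{k+1}=y_i^k$ for $i\neq i_k$; - $z^{k+1}=z^k+\frac1N\left[\left(x_{i_k}^{k+1}-\frac{y_{i_k}^{k+1}}{\rho}\right)-\left(x_{i_k}^{k}-\frac{y_{i_k}^{k}}{\rho}\right)\right]$. Here $\boldsymbol{x}^k=(x_1^k,\dots,x_N^k)$ and $\boldsymbol{y}^k=(y_1^k,\dots,y_N^k)$. KKT conditions: a point $(\boldsymbol{x}^*,\boldsymbol{y}^*,z^* )$ satisfies the KKT conditions of the problem if $\nabla f_i(x_i^* )-y_i^*=\boldsymbol{0}$ for all $i\in\mathcal{V}$, $\sum_{i=1}^N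 y_i^*=\boldsymbol{0}$, and $z^*=x_i^*$ for all $i\in\mathcal{V}$. *)

(* Defs.v *)
From HB Require Import structures.
From mathcomp Require Import all_boot all_order all_algebra.
From mathcomp Require Import all_classical all_reals all_analysis.

Set Implicit Arguments.
Unset Strict Implicit.
Unset Printing Implicit Defensive.

Import Order.TTheory GRing.Theory Num.Theory.
Import numFieldNormedType.Exports.

Local Open Scope classical_set_scope.
Local Open Scope ring_scope.

Section Definitions.
Context {R : realType}.

(* The library norm `|A| on matrices is the max norm, whereas the Lipschitz
   condition and the proximal term refer to the Euclidean one.  A point
   (x_1, ..., x_N) of R^(pN) is encoded as the N x p matrix with rows x_i,
   hence the definition on all matrices. *)
Definition enorm m n (A : 'M[R]_(m, n)) : R :=
  Num.sqrt (\sum_(i < m) \sum_(j < n) A i j ^+ 2).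

(* This is the gradient provided f is differentiable at x. *)
Definition grad p (f : 'rV[R]_p -> R) (x : 'rV[R]_p) : 'rV[R]_p :=
  \row_(j < p) 'D_(delta_mx 0 j) (f : 'rV[R]_p -> R^o) x.

Definition coercive m n (F : 'M[R]_(m, n) -> R) : Prop :=
  forall M : R, exists r : R, forall x, r < enorm x -> M < F x.

Definition argmin (T : Type) (g : T -> R) : set T :=
  [set a | forall b, g a <= g b].

Definition separable_sum N p (f : 'I_N -> 'rV[R]_p -> R) (x : 'M[R]_(N, p)) : R :=
  \sum_(i < N) f i (row i x).

(* The agents are numbered from 0, so the one activated at iteration k is
   k %% N.  The argmin is a singleton as soon as rho * gamma k exceeds the
   Lipschitz constant of the gradients. *)
Record PI_ADMM1 N p (f : 'I_N -> 'rV[R]_p -> R) (rho : R) (gamma : nat -> R)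
    (x y : nat -> 'M[R]_(N, p)) (z : nat -> 'rV[R]_p) : Prop := {
  rho_gt0 : 0 < rho ;
  gamma_gt0 : forall k, 0 < gamma k ;
  z_init : z 0%N = 0 ;
  y_init : forall i, row i (y 0%N) = rho *: row i (x 0%N) ;
  x_active : forall k (i : 'I_N), i = (k %% N)%N :> nat ->
    argmin (fun w : 'rV[R]_p => f i w + rho * gamma k / 2 *
        enorm (z k - w + (rho * gamma k)^-1 *: row i (y k)) ^+ 2)
      (row i (x k.+1)) ;
  x_idle : forall k (i : 'I_N), i <> (k %% N)%N :> nat ->
    row i (x k.+1) = row i (x k) ;
  y_active : forall k (i : 'I_N), i = (k %% N)%N :> nat ->
    row i (y k.+1) = row i (y k) + (rho * gamma k) *: (z k - row i (x k.+1)) ;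
  y_idle : forall k (i : 'I_N), i <> (k %% N)%N :> nat ->
    row i (y k.+1) = row i (y k) ;
  z_step : forall k (i : 'I_N), i = (k %% N)%N :> nat ->
    z k.+1 = z k + N%:R^-1 *: ((row i (x k.+1) - rho^-1 *: row i (y k.+1))
                             - (row i (x k) - rho^-1 *: row i (y k)))
}.

Definition KKT N p (f : 'I_N -> 'rV[R]_p -> R)
    (w : 'M[R]_(N, p) * 'M[R]_(N, p) * 'rV[R]_p) : Prop :=
  let: (x, y, z) := w in
  [/\ forall i, grad (f i) (row i x) - row i y = 0,
      \sum_(i < N) row i y = 0
    & forall i, z = row i x].

End Definitions.

(* A cluster point of the filter u @ \oo: each of its neighbourhoods contains
   u k for arbitrarily large k. *)
Definition limit_points (T : topologicalType) (u : nat -> T) : set T :=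
  cluster (u @ \oo).

(* Main.v *)
(* The Lyapunov function is the augmented Lagrangian
     sum_i f_i(x_i) + <y_i, z - x_i> + rho/2 |z - x_i|^2.
   Optimality of the proximal step gives y_i = grad f_i(x_i) once agent i has been
   active, and the initialisation makes z the mean of the x_i - y_i/rho, i.e. the
   exact minimiser of the Lagrangian in z.  Hence, after the first N iterations,
   each iteration decreases the Lagrangian by at least
   c |x^{k+1} - x^k|^2 + N rho/2 |z^{k+1} - z^k|^2.  By the descent lemma it
   dominates F(z,...,z) + (rho - L)/2 sum_i |z - x_i|^2, so that coercivity bounds
   the iterates and all increments vanish.  Since z^k - x_i^{k+1} is
   (y_i^{k+1} - y_i^k)/(rho gamma_k) for the active agent, the residuals z - x_i
   vanish too, and so does sum_i y_i = rho sum_i (x_i - z). *)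
Require Import Defs.
From HB Require Import structures.
From mathcomp Require Import all_boot all_order all_algebra.
From mathcomp Require Import all_classical all_reals all_analysis.
From mathcomp Require Import ring lra zify.

Set Implicit Arguments.
Unset Strict Implicit.
Unset Printing Implicit Defensive.

Import Order.TTheory GRing.Theory Num.Theory.
Import numFieldNormedType.Exports.

Local Open Scope classical_set_scope.
Local Open Scope ring_scope.

(** * Euclidean inner product on row vectors *)

Section Dot.
Context {R : realType} {p : nat}.
Implicit Types (u v w : 'rV[R]_p) (a c : R).

Definition dot u v : R := \sum_(j < p) u 0 j * v 0 j.

Lemma dotC u v : dot u v = dot v u.
Proof. by apply: eq_bigr => j _; rewrite mulrC. Qed.

Lemma dotDl u v w : dot (u + v) w = dot u w + dot v w.
Proof. by rewrite -big_split; apply: eq_bigr => j _; rewrite mxE mulrDl. Qed.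

Lemma dotZl a u v : dot (a *: u) v = a * dot u v.
Proof. by rewrite mulr_sumr; apply: eq_bigr => j _; rewrite mxE mulrA. Qed.

Lemma dotNl u v : dot (- u) v = - dot u v.
Proof. by rewrite -scaleN1r dotZl mulN1r. Qed.

Lemma dotDr u v w : dot u (v + w) = dot u v + dot u w.
Proof. by rewrite dotC dotDl ![dot _ u]dotC. Qed.

Lemma dotZr a u v : dot u (a *: v) = a * dot u v.
Proof. by rewrite dotC dotZl dotC. Qed.

Lemma dotNr u v : dot u (- v) = - dot u v.
Proof. by rewrite dotC dotNl dotC. Qed.

Lemma dot0l v : dot 0 v = 0.
Proof. by rewrite -(scale0r 0) dotZl mul0r. Qed.

Definition dotE := (dotDl, dotDr, dotNl, dotNr, dotZl, dotZr).

Lemma dot_suml (I : finType) (F : I -> 'rV[R]_p) v :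
  dot (\sum_i F i) v = \sum_i dot (F i) v.
Proof.
by apply: (big_morph (dot^~ v)) => [u w|]; rewrite ?dotDl ?dot0l.
Qed.

Lemma dot_ge0 u : 0 <= dot u u.
Proof. by apply: sumr_ge0 => j _; rewrite -expr2 sqr_ge0. Qed.

Lemma sqr_coord_le u j : u 0 j ^+ 2 <= dot u u.
Proof.
rewrite /dot (bigD1 j) //= -expr2 lerDl.
by apply: sumr_ge0 => i _; rewrite -expr2 sqr_ge0.
Qed.

Lemma dot_eq0 u : dot u u <= 0 -> u = 0.
Proof.
move=> u0; apply/rowP => j; rewrite mxE; apply/eqP; rewrite -sqrf_eq0 eq_le.
by rewrite sqr_ge0 (le_trans (sqr_coord_le u j)).
Qed.

Lemma enorm_sqr u : enorm u ^+ 2 = dot u u.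
Proof.
rewrite sqr_sqrtr; last by do 2![apply: sumr_ge0 => ? _]; exact: sqr_ge0.
by rewrite big_ord1; apply: eq_bigr => j _; rewrite expr2.
Qed.

(** Cauchy-Schwarz without square roots: expanding [|u - c v|^2 >= 0] gives [2 c <u, v> <= |u|^2 +
    c^2 |v|^2 <= 2 c^2 |v|^2], and one divides by [c], the case [c = 0] being separate. *)
Lemma dot_le u v c : 0 <= c -> dot u u <= c ^+ 2 * dot v v ->
  dot u v <= c * dot v v.
Proof.
rewrite le_eqVlt => /predU1P[<-|c0] uv.
  rewrite expr2 !mul0r in uv *.
  by rewrite (dot_eq0 uv) dot0l.
have := dot_ge0 (u - c *: v); rewrite !dotE (dotC v u) => h.
rewrite -(ler_pM2l c0); nra.
Qed.

Lemma dotD_le u v : dot (u + v) (u + v) <= 2 * dot u u + 2 * dot v v.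
Proof. by have := dot_ge0 (u - v); rewrite !dotE (dotC v u); lra. Qed.

End Dot.

(** * Functions with Lipschitz gradient: descent lemma and optimality of the proximal step *)

Section Smooth.
Context {R : realType} {p : nat}.
Variables (f : 'rV[R]_p -> R) (L : R).
Hypothesis L_gt0 : 0 < L.
Hypothesis f_diff : forall x, differentiable (f : 'rV[R]_p -> R^o) x.
Hypothesis f_smooth : forall u v,
  enorm (grad f u - grad f v) <= L * enorm (u - v).

Lemma grad_lip u v : dot (grad f u - grad f v) (grad f u - grad f v) <=
  L ^+ 2 * dot (u - v) (u - v).
Proof.
rewrite -!enorm_sqr -exprMn; apply: lerXn2r; rewrite ?nnegrE //.
  exact: sqrtr_ge0.
by apply: mulr_ge0; [exact: ltW|exact: sqrtr_ge0].
Qed.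

Lemma diff_grad x d : 'd (f : 'rV[R]_p -> R^o) x d = dot (grad f x) d.
Proof.
rewrite [in LHS](row_sum_delta d) linear_sum; apply: eq_bigr => j _.
by rewrite linearZ /= mxE deriveE// mulrC.
Qed.

Lemma is_derive_line u d t :
  is_derive (t : R) 1 (fun s => f (u + s *: d) : R^o) (dot (grad f (u + t *: d)) d).
Proof.
have E : (fun h : R => h^-1 *: (((fun s => f (u + s *: d) : R^o) \o shift t) (h *: (1 : R))
             - (f (u + t *: d) : R^o))) =
         (fun h : R => h^-1 *: (((f : 'rV[R]_p -> R^o) \o shift (u + t *: d)) (h *: d)
             - (f (u + t *: d) : R^o))).
  apply/funext => h /=; congr (_ *: (f _ - _)).
  by rewrite /shift /= -[h *: 1]/(h * 1) mulr1 scalerDl addrCA.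
apply: DeriveDef; rewrite /derivable /derive E.
  exact: diff_derivable (f_diff _).
by rewrite -diff_grad -deriveE.
Qed.

Lemma descent u v :
  f v <= f u + dot (grad f u) (v - u) + L / 2 * dot (v - u) (v - u).
Proof.
set d := v - u; set G := grad f u.
(* Along the segment from [u] to [v], [psi] is [f] minus the claimed quadratic upper model, up to
   the constant [f u]. The Lipschitz bound makes [dpsi] nonpositive for [t >= 0], so the mean value
   theorem yields [psi 1 <= psi 0]. *)
pose psi (t : R) : R := f (u + t *: d) - (t * dot G d + L / 2 * dot d d * t ^+ 2).
pose dpsi t := dot (grad f (u + t *: d)) d - (dot G d + L * dot d d * t).
have dpsiP t : is_derive (t : R) 1 (psi : R -> R^o) (dpsi t).
  have ? := is_derive_line u d t.
  rewrite /psi /dpsi; apply: is_derive_eq.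
  rewrite /GRing.scale /= mulr0 add0r !mulr1; congr (_ - (_ + _)).
  by rewrite -mulr2n; field.
have psi_cont : {within `[0, 1], continuous psi}.
  apply: derivable_within_continuous => s _.
  exact: (@ex_derive _ _ _ _ _ _ _ (dpsiP s)).
have [t] := MVT ltr01 (fun s _ => dpsiP s) psi_cont.
rewrite in_itv /= => /andP[t0 _].
have : dot (grad f (u + t *: d) - G) d <= L * t * dot d d.
  apply: dot_le; first by rewrite mulr_ge0// ltW.
  apply: le_trans (grad_lip _ _) _.
  by rewrite addrAC subrr add0r dotZl dotZr; lra.
rewrite /psi /dpsi dotDl dotNl scale1r scale0r addr0 [u + d]addrC subrK.
nra.
Qed.

(* With [G] the gradient of the objective at its minimiser [w], the descent lemma
   gives [0 <= <G, h> + (L + a) / 2 * |h|^2] for every [h], which forces [G = 0]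
   (take [h] proportional to [- G]). *)
Lemma argmin_grad (a : R) (b w : 'rV[R]_p) : 0 < a ->
  argmin (fun v => f v + a / 2 * enorm (b - v) ^+ 2) w ->
  grad f w = a *: (b - w).
Proof.
move=> a0 wmin; set G := grad f w - a *: (b - w).
suff : G = 0 by move/eqP; rewrite subr_eq0 => /eqP.
have eG : grad f w = G + a *: (b - w) by rewrite subrK.
have La : 0 < L + a by rewrite addr_gt0.
have quad h : 0 <= dot G h + (L + a) / 2 * dot h h.
  have := descent w (w + h); have := wmin (w + h).
  rewrite !enorm_sqr [w + h - w]addrAC subrr add0r opprD addrA eG.
  move: (b - w) => e; clearbody G.
  rewrite !dotE !(dotC h); lra.
apply: dot_eq0; clearbody G.
set t := (L + a)^-1; have := quad (- (t *: G)).
rewrite !dotE; set g := dot G G.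
have -> : - (t * g) + (L + a) / 2 * - - (t * (t * g)) = - (t * g) / 2.
  by rewrite /t; field; rewrite gt_eqF.
have : 0 < t by rewrite invr_gt0.
nra.
Qed.

End Smooth.

(** * Convergence, cluster points and compactness *)

Section Limits.
Context {R : realType}.

Lemma cvgM_cst0 {T : Type} {F : set_system T} {FF : Filter F} (a : R) (u : T -> R) :
  u @ F --> (0 : R) -> (fun t => a * u t) @ F --> (0 : R).
Proof. by move=> u0; have := cvgMl_tmp (a := a) u0; rewrite mulr0; exact. Qed.

Lemma cvg_sqr_le0 {T : Type} {F : set_system T} {FF : Filter F} (a D : T -> R) :
  D @ F --> (0 : R) -> (\forall t \near F, a t ^+ 2 <= D t) -> a @ F --> (0 : R).
Proof.
move=> D0 aD; apply/cvgr0Pnorm_lt => e e0.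
have /cvgr0Pnorm_lt /(_ _ (exprn_gt0 2 e0)) De := D0.
near=> t; rewrite -(@ltr_pXn2r _ 2%N) ?nnegrE ?(ltW e0)// real_normK ?num_real//.
apply: (@le_lt_trans _ _ (D t)); first by near: t.
by apply: le_lt_trans (ler_norm _) _; near: t.
Unshelve. all: by end_near. Qed.

Lemma cvg_decrement (u : R^nat) (n0 : nat) (m : R) :
  (forall n, (n0 <= n)%N -> u n.+1 <= u n) ->
  (forall n, (n0 <= n)%N -> m <= u n) ->
  (fun n => u n - u n.+1) @ \oo --> (0 : R).
Proof.
move=> u_ni u_lb; rewrite -(cvg_shiftn n0).
have /cvg_ex[/= l ul] : cvgn (fun n => u (n + n0)%N).
  apply: nonincreasing_is_cvgn.
    by apply/nonincreasing_seqP => n; rewrite addSn; apply/u_ni/leq_addl.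
  by exists m => _ [n _ <-]; apply/u_lb/leq_addl.
have ulS : (fun n => u (n.+1 + n0)%N) @ \oo --> l.
  by rewrite (cvg_shiftS (fun n => u (n + n0)%N)).
by have := cvgB ul ulS; rewrite subrr; exact.
Qed.

(* The residual [z - x_i] is only controlled when agent [i] is active, once every
   [N] steps; in between it drifts by vanishing increments. *)
Lemma cvg_periodic_reset (N i : nat) (g d : R^nat) : (i < N)%N ->
  (forall k, 0 <= g k) -> d @ \oo --> (0 : R) ->
  (forall k, g k.+1 <= d k + (if (k %% N == i)%N then 0 else g k)) ->
  g @ \oo --> (0 : R).
Proof.
move=> iN g_ge0 d0 gd; apply/cvgr0Pnorm_lt => e e0.
(* Between two resets at most [N] increments accumulate, and [N * e' < e]. *)
pose e' := e / N.+1%:R; have e'0 : 0 < e' by rewrite divr_gt0.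
have /cvgr0Pnorm_lt /(_ _ e'0) [K _ dK] := d0.
have {}dK k : (K <= k)%N -> d k <= e'.
  by move=> /dK /= /ltW; apply: le_trans (ler_norm _).
have growth m t : (K <= m * N + i)%N -> g (m * N + i + t.+1)%N <= t.+1%:R * e'.
  move=> Km; elim: t => [|t IH].
    rewrite mul1r addn1; apply: le_trans (gd _) _.
    by rewrite modnMDl modn_small// eqxx addr0 dK.
  rewrite addnS -natr1 mulrDl mul1r addrC; apply: le_trans (gd _) _.
  apply: lerD; first by apply: dK; lia.
  by case: ifP => // _; rewrite mulr_ge0// ltW.
exists (K + N + i.+1)%N => // k /= Kk.
(* The index [k] is split as the last reset [m * N + i] before it plus [t + 1] steps with [t < N];
   the threshold on [k] ensures that this reset comes after [K]. *)
have kE : k = ((k - i.+1) %/ N * N + i + ((k - i.+1) %% N).+1)%N.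
  by have := divn_eq (k - i.+1) N; lia.
have tN : ((k - i.+1) %% N < N)%N by rewrite ltn_mod; lia.
rewrite ger0_norm// kE; apply: le_lt_trans (growth _ _ _) _.
  by have := divn_eq (k - i.+1) N; lia.
rewrite /e' mulrCA -[ltRHS]mulr1 ltr_pM2l// ltr_pdivrMr// mul1r ltr_nat.
by rewrite ltnS.
Qed.

(** By continuity [h w] is a cluster point of [h \o u], and a convergent filter in a Hausdorff space
    clusters only at its limit. *)
Lemma limit_points_cvg0 (T : topologicalType) (u : nat -> T) (h : T -> R) (w : T) :
  limit_points u w -> {for w, continuous h} -> (h \o u) @ \oo --> (0 : R) ->
  h w = 0.
Proof.
move=> uw hw hu; apply/esym/(@norm_hausdorff R R) => A B A0 Bw.
have [t [At Bt]] := uw (h @^-1` A) (h @^-1` B) (hu _ A0) (hw _ Bw).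
by exists (h t).
Qed.

Lemma cvg_sumr {T : Type} {F : set_system T} {FF : Filter F} (I : finType)
  (u : I -> T -> R) (l : I -> R) : (forall i, u i @ F --> l i) ->
  (fun t => \sum_i u i t) @ F --> \sum_i l i.
Proof. by move=> ul; apply: cvg_big => //; exact: add_continuous. Qed.

Lemma cvg_sumr0 {T : Type} {F : set_system T} {FF : Filter F} (I : finType)
  (u : I -> T -> R) : (forall i, u i @ F --> (0 : R)) ->
  (fun t => \sum_i u i t) @ F --> (0 : R).
Proof. by move=> /cvg_sumr; rewrite big1//; exact. Qed.

(** Passes from a Euclidean bound to the max-norm topology: [|u - v|^2] is a finite sum of squared
    coordinates, each tending to 0. *)
Lemma cvg_sqr_lipschitz {p : nat} {F : set_system 'rV[R]_p} {FF : Filter F}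
    (g : 'rV[R]_p -> R) (v : 'rV[R]_p) (C : R) : F --> v ->
  (forall u, (g u - g v) ^+ 2 <= C * dot (u - v) (u - v)) -> g @ F --> g v.
Proof.
move=> Fv gC; apply/subr_cvg0.
apply: (@cvg_sqr_le0 _ _ _ _ (fun u => C * dot (u - v) (u - v)));
  last by apply: nearW => u; exact: gC.
apply: cvgM_cst0; apply: (@cvg_sumr0 _ _ _ _ (fun k u => (u - v) 0 k * (u - v) 0 k)) => k.
have uv0 : (fun u => u 0 k - v 0 k) @ F --> (0 : R).
  by apply/subr_cvg0; exact: (cvg_comp _ _ Fv (@coord_continuous R 1 p 0 k v)).
under eq_fun do rewrite !mxE.
by have := cvgM uv0 uv0; rewrite mulr0; exact.
Qed.

Lemma row_continuous m n i : continuous (fun A : 'M[R]_(m, n) => row i A).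
Proof.
move=> A U /nbhs_ballP[e e0 eU]; apply/nbhs_ballP; exists e => // B AB.
by apply: eU; split=> // k j; rewrite !mxE; exact: AB.2.
Qed.

(** The box is the image of a product of segments in dimension [m * n] under the continuous map
    [vec_mx]. *)
Lemma compact_mx_box m n (B : R) :
  compact [set A : 'M[R]_(m, n) | forall i j, `|A i j| <= B].
Proof.
have /continuous_compact : {within [set v : 'rV[R]_(m * n) |
    forall k, `[- B, B]%classic (v ord0 k)], continuous (@vec_mx R m n)}.
  apply: continuous_subspaceT => v A /nbhs_ballP[e e0 eA].
  apply/nbhs_ballP; exists e => // w vw; apply: eA; split=> // i j.
  by rewrite !mxE; exact: vw.2.
move=> /(_ (rV_compact (fun=> @segment_compact R _ _))).
congr (compact _); apply/seteqP; split => [_ [v vB <-] i j|A AB].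
  by rewrite mxE ler_norml; have := vB (mxvec_index i j); rewrite /= in_itv.
exists (mxvec A); rewrite ?mxvecK// => k; case/mxvec_indexP: k => i j.
by rewrite /= mxvecE in_itv /= -ler_norml.
Qed.

Lemma rows_bounded_compact m n (n0 : nat) (u : nat -> 'M[R]_(m, n)) :
  (forall i, exists B, forall k, (n0 <= k)%N -> dot (row i (u k)) (row i (u k)) <= B) ->
  exists2 K : set 'M[R]_(m, n), compact K & forall k, (n0 <= k)%N -> K (u k).
Proof.
move=> /choice[B uB]; exists [set A | forall i j, `|A i j| <= Num.sqrt (\sum_i `|B i|)].
  exact: compact_mx_box.
move=> k Nk i j /=; rewrite -sqrtr_sqr ler_wsqrtr// (le_trans _ (_ : B i <= _))//.
  by have := sqr_coord_le (row i (u k)) j; rewrite mxE => /le_trans; apply; exact: uB.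
by rewrite (bigD1 i)//= (le_trans (ler_norm _))// lerDl sumr_ge0.
Qed.

End Limits.

(* Contribution of one agent to the augmented Lagrangian. *)
Definition lagr {R : realType} {p : nat} (f : 'rV[R]_p -> R) (rho : R)
  (z x y : 'rV[R]_p) : R :=
  f x + dot y (z - x) + rho / 2 * dot (z - x) (z - x).

(** * One-step estimates for the augmented Lagrangian *)

Section Lagrangian.
Context {R : realType} {p : nat}.
Implicit Types (x y z : 'rV[R]_p) (rho : R).

(** Let [D = x' - x] and [s = z - x']. The descent lemma gains [(rho - L) / 2 * |D|^2]; against it
    stand [rho <s, D>] and the dual ascent term [rho g |s|^2]. Since [rho g s] is a gradient
    difference, of norm at most [L |D|], each costs at most [L / g * |D|^2]. *)
Lemma lagr_agent_step (f : 'rV[R]_p -> R) (L rho g : R) x x' z : 0 < L -> L < rho -> 0 < g ->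
  (forall x, differentiable (f : 'rV[R]_p -> R^o) x) ->
  (forall u v, enorm (grad f u - grad f v) <= L * enorm (u - v)) ->
  grad f x' - grad f x = (rho * g) *: (z - x') ->
  lagr f rho z x' (grad f x') + ((rho - L) / 2 - 2 * L / g) * dot (x' - x) (x' - x)
  <= lagr f rho z x (grad f x).
Proof.
move=> L0 Lrho g0 f_diff f_lip; have rho0 : 0 < rho by lra.
rewrite /lagr; have := descent L0 f_diff f_lip x x'.
have := grad_lip L0 f_lip x' x.
have -> : z - x = (z - x') + (x' - x) by rewrite addrA subrK.
move: (grad f x') (grad f x) (x' - x) (z - x') => y' y D s lip fx' ys.
have y'E : y' = y + (rho * g) *: s by rewrite -ys addrC subrK.
rewrite {}ys in lip; rewrite {}y'E.
have sD : - (rho * g * dot s D) <= L * dot D D.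
  rewrite -dotZl -dotNl; apply: dot_le; first exact: ltW.
  by rewrite dotNl dotNr opprK.
rewrite !dotE (dotC D s) in lip *; have := dot_ge0 D.
have [q0 Lq] : 0 < L / g /\ L = L / g * g.
  by rewrite divr_gt0// divfK// gt_eqF.
rewrite -(mulrA 2); move: (L / g) q0 Lq => q q0 Lq.
move: (dot s s) (dot D D) (dot s D) (dot y s) (dot y D) lip fx' sD.
move=> ss DD sD ys yD lip fx' sDle DD0.
have H1 : - (rho * sD) <= q * DD.
  by rewrite -(ler_pM2l g0); rewrite Lq in sDle; lra.
(* Multiplied by [rho * g], the left side is the squared dual increment, at most [L^2 |D|^2]; then
   [L < rho] gives [L^2 <= rho * L = rho * g * q]. *)
have H2 : rho * g * ss <= q * DD.
  rewrite -(ler_pM2l (mulr_gt0 rho0 g0)); apply: le_trans (_ : L ^+ 2 * DD <= _).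
    by lra.
  rewrite mulrA ler_wpM2r// expr2 {1}Lq; nra.
lra.
Qed.

(** Taylor expansion in [z] around [z'], exact because the dependence is quadratic;
    [y - rho x + rho z'] is the gradient at [z']. *)
Lemma lagr_shift f rho z z' x y :
  lagr f rho z x y = lagr f rho z' x y
    + (dot (y - rho *: x + rho *: z') (z - z') + rho / 2 * dot (z - z') (z - z')).
Proof.
rewrite /lagr; have -> : z - x = (z - z') + (z' - x) by rewrite addrA subrK.
have -> : y - rho *: x + rho *: z' = y + rho *: (z' - x).
  by rewrite -addrA scalerBr [- _ + _]addrC.
move: (z - z') (z' - x) => s t; by rewrite !dotE (dotC t s); field.
Qed.

(* The hypothesis says that [z'] minimises the quadratic function of [z] on the
   right-hand side, so that only the second-order term remains. *)
Lemma lagr_consensus_step N (f : 'I_N -> 'rV[R]_p -> R) rho z z' (x y : 'I_N -> 'rV[R]_p) :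
  0 < rho -> \sum_i (x i - rho^-1 *: y i) = N%:R *: z' ->
  \sum_i lagr (f i) rho z' (x i) (y i) + N%:R * (rho / 2 * dot (z - z') (z - z')) =
  \sum_i lagr (f i) rho z (x i) (y i).
Proof.
move=> rho0 zE; under [RHS]eq_bigr do rewrite (lagr_shift _ _ _ z').
rewrite !big_split /= sumr_const card_ord -dot_suml mulr_natl.
suff -> : \sum_i (y i - rho *: x i + rho *: z') = 0 by rewrite dot0l add0r.
rewrite big_split /= sumr_const card_ord -scaler_nat scalerA mulrC -scalerA -zE.
rewrite scaler_sumr -big_split; apply: big1 => i _ /=.
by rewrite scalerBr scalerA mulfV ?gt_eqF// scale1r addrC addrA subrK subrr.
Qed.

(** With the gradient as multiplier, [f x + <y, z - x>] is the linearisation of [f] at [x], which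
    the descent lemma compares with [f z] at a cost of [L / 2 * |z - x|^2]. *)
Lemma lagr_ge (f : 'rV[R]_p -> R) (L rho : R) x z : 0 < L ->
  (forall x, differentiable (f : 'rV[R]_p -> R^o) x) ->
  (forall u v, enorm (grad f u - grad f v) <= L * enorm (u - v)) ->
  f z + (rho - L) / 2 * dot (z - x) (z - x) <= lagr f rho z x (grad f x).
Proof.
move=> L0 f_diff f_lip; rewrite /lagr.
have := descent L0 f_diff f_lip x z; lra.
Qed.

End Lagrangian.

Lemma descent_rate_gt0 (R : realFieldType) (L rho g : R) :
  0 < g -> 4 * L < g * (rho - L) -> 0 < (rho - L) / 2 - 2 * L / g.
Proof. by move=> g_gt0; rewrite subr_gt0 ltr_pdivrMr//; lra. Qed.

(** * Setting and invariants of the PI-ADMM1 iteration *)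

Section Iterates.
Context {R : realType} {N p : nat}.
Hypothesis N_gt0 : (0 < N)%N.
Variables (f : 'I_N -> 'rV[R]_p -> R) (L : R).
Hypothesis L_gt0 : 0 < L.
Hypothesis f_diff : forall i x, differentiable (f i : 'rV[R]_p -> R^o) x.
Hypothesis f_smooth : forall i u v,
  enorm (grad (f i) u - grad (f i) v) <= L * enorm (u - v).
Hypothesis F_bounded : has_lbound (range (separable_sum f)).
Hypothesis F_coercive : coercive (separable_sum f).
Variables (rho : R) (gamma : nat -> R).
Variables (x y : nat -> 'M[R]_(N, p)) (z : nat -> 'rV[R]_p).
Hypothesis iterates : PI_ADMM1 f rho gamma x y z.
Hypothesis rho_gtL : L < rho.
Variable g0 : R.
Hypothesis g0_gt0 : 0 < g0.
Hypothesis g0_large : 4 * L < g0 * (rho - L).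
Hypothesis gamma_ge : forall k, g0 <= gamma k.

Let rho_gt0 : 0 < rho. Proof. exact: rho_gt0 iterates. Qed.
Let gamma_gt0 k : 0 < gamma k. Proof. exact: gamma_gt0 iterates k. Qed.
(** The rate of [lagr_agent_step] with [gamma k] replaced by its lower bound [g0], hence uniform in
    [k]. *)
Let c : R := (rho - L) / 2 - 2 * L / g0.

Let active k : 'I_N := Ordinal (ltn_pmod k N_gt0).

Let active_mod k : active k = (k %% N)%N :> nat. Proof. by []. Qed.

Let c_gt0 : 0 < c. Proof. exact: descent_rate_gt0. Qed.

Lemma idle_neq k i : i != active k -> i <> (k %% N)%N :> nat.
Proof. by move=> /eqP ia E; apply/ia/val_inj. Qed.

(** Completing the prox centre to [z + y / (rho gamma)], stationarity reads
    [grad f = y + rho gamma (z - x)] at the new [x], which is the dual update. *)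
Lemma active_grad k : grad (f (active k)) (row (active k) (x k.+1)) = row (active k) (y k.+1).
Proof.
have a_gt0 : 0 < rho * gamma k by rewrite mulr_gt0.
rewrite (y_active iterates (active_mod k)).
rewrite (@argmin_grad _ _ _ L L_gt0 _ _ _
  (z k + (rho * gamma k)^-1 *: row (active k) (y k)) _ a_gt0)//.
  by rewrite addrAC scalerDr scalerA mulfV ?gt_eqF// scale1r [LHS]addrC.
move=> w; rewrite ![z k + _ - _]addrAC.
exact: (x_active iterates (active_mod k)).
Qed.

(** An active step establishes the equality and idle steps change neither side; agent [i] is first
    active at iteration [i], so at index [N] all agents satisfy it. *)
Lemma visited_grad k (i : 'I_N) : (i < k)%N -> grad (f i) (row i (x k)) = row i (y k).
Proof.
elim: k => // k IH; have [->|/idle_neq ik] := eqVneq i (active k).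
  by move=> _; exact: active_grad.
rewrite ltnS leq_eqVlt => /predU1P[E|{}/IH].
  by case: ik; rewrite E modn_small// -E.
by rewrite (x_idle iterates ik) (y_idle iterates ik).
Qed.

(** The initialisation makes both sides zero, and the [z] update adds 1/N times the change of the
    only summand that moves. *)
Lemma consensus k : \sum_i (row i (x k) - rho^-1 *: row i (y k)) = N%:R *: z k.
Proof.
elim: k => [|k IH].
  rewrite (z_init iterates) scaler0; apply: big1 => i _.
  by rewrite (y_init iterates) scalerA mulVf ?gt_eqF// scale1r subrr.
rewrite (z_step iterates (active_mod k)).
rewrite scalerDr -IH scalerA mulfV ?pnatr_eq0 -?lt0n// scale1r.
rewrite (bigD1 (active k)) //= [in RHS](bigD1 (active k)) //=.
rewrite [RHS]addrC [RHS]addrA subrK; congr (_ + _); apply: eq_bigr => i /idle_neq ik.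
by rewrite (x_idle iterates ik) (y_idle iterates ik).
Qed.

(** * Monotonicity and lower bounds of the Lagrangian along the iterates *)

Let lagr_at k : R := \sum_i lagr (f i) rho (z k) (row i (x k)) (row i (y k)).

Lemma active_dy k : row (active k) (y k.+1) - row (active k) (y k) =
  (rho * gamma k) *: (z k - row (active k) (x k.+1)).
Proof.
by rewrite (y_active iterates (active_mod k)) addrAC subrr add0r.
Qed.

(** The iteration is split into the active agent's step at fixed [z k], then the move to [z k.+1].
    An idle [i] has zero increment, so the bound holds for every agent. *)
Lemma lagr_decrease k i : (N <= k)%N ->
  lagr_at k.+1 + c * dot (row i (x k.+1) - row i (x k)) (row i (x k.+1) - row i (x k))
    + N%:R * (rho / 2 * dot (z k - z k.+1) (z k - z k.+1)) <= lagr_at k.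
Proof.
move=> Nk; rewrite addrAC lagr_consensus_step//; last exact: consensus.
rewrite /lagr_at (bigD1 (active k)) //= [leRHS](bigD1 (active k)) //= addrAC lerD//; last first.
  by apply: ler_sum => j /idle_neq jk; rewrite (x_idle iterates jk) (y_idle iterates jk).
(* The agent step needs the gradient identity already before the update, hence an earlier
   activation; this is where [N <= k] enters. *)
have ak : (active k < k)%N by rewrite (leq_trans (ltn_ord _)).
have := active_dy k; rewrite -active_grad -visited_grad// => dy.
apply: le_trans (lagr_agent_step L_gt0 rho_gtL (gamma_gt0 k) (f_diff _) (f_smooth _) dy).
rewrite lerD2l; apply: (@le_trans _ _ (c *
    dot (row (active k) (x k.+1) - row (active k) (x k))
     (row (active k) (x k.+1) - row (active k) (x k)))).
  rewrite ler_pM2l//; have [->//|/idle_neq ik] := eqVneq i (active k).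
  by rewrite (x_idle iterates ik) subrr dot0l dot_ge0.
rewrite ler_wpM2r ?dot_ge0// /c lerD2l lerN2 ler_wpM2l//; first by rewrite mulr_ge0// ltW.
by rewrite lef_pV2 ?posrE.
Qed.

Lemma lagr_at_ge k i : (N <= k)%N ->
  separable_sum f (\matrix_(_ < N, j < p) z k 0 j)
    + (rho - L) / 2 * dot (z k - row i (x k)) (z k - row i (x k)) <= lagr_at k.
Proof.
move=> Nk; rewrite /separable_sum.
under eq_bigr => j _ do [rewrite (_ : row j _ = z k); last by apply/rowP => ?; rewrite !mxE].
have rL : 0 <= (rho - L) / 2 by rewrite divr_ge0// subr_ge0 ltW.
apply: (@le_trans _ _ (\sum_j (f j (z k) + (rho - L) / 2 *
    dot (z k - row j (x k)) (z k - row j (x k))))).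
  rewrite big_split lerD2l [leRHS](bigD1 i)//= lerDl; apply: sumr_ge0 => j _.
  by rewrite mulr_ge0 ?dot_ge0.
apply: ler_sum => j _; rewrite -visited_grad; last exact: leq_trans (ltn_ord j) Nk.
exact: (lagr_ge _ _ _ L_gt0 (f_diff j) (f_smooth j)).
Qed.

Lemma lagr_at_nonincreasing k : (N <= k)%N -> lagr_at k.+1 <= lagr_at k.
Proof.
move=> Nk; apply: le_trans (lagr_decrease (active k) Nk).
by rewrite -addrA lerDl addr_ge0// !mulr_ge0 ?dot_ge0 ?invr_ge0 ?ler0n ?ltW.
Qed.

Lemma lagr_at_le k : (N <= k)%N -> lagr_at k <= lagr_at N.
Proof.
elim: k => [|k IH]; first by rewrite leqn0 => /eqP->.
rewrite leq_eqVlt => /predU1P[->//|]; rewrite ltnS => Nk.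
exact: le_trans (lagr_at_nonincreasing Nk) (IH Nk).
Qed.

(** * Boundedness of the iterates *)

Lemma lagr_at_bounded : exists m, forall k, (N <= k)%N -> m <= lagr_at k.
Proof.
have [m Fm] := F_bounded; exists m => k Nk.
apply: le_trans (lagr_at_ge (active k) Nk).
rewrite -[leLHS]addr0 lerD//; first exact: (Fm _ (imageT _ _)).
by rewrite mulr_ge0 ?divr_ge0 ?dot_ge0 ?subr_ge0// ltW.
Qed.

Lemma z_sqr_bounded : exists B, forall k, (N <= k)%N -> dot (z k) (z k) <= B.
Proof.
(* The radius comes from coercivity at the level [lagr_at N], which bounds [F(z, ..., z)] from then
   on. *)
have [r Fr] := F_coercive (lagr_at N); exists (r ^+ 2) => k Nk.
set Z : 'M[R]_(N, p) := \matrix_(i, j) z k 0 j.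
have ZN : enorm Z <= r.
  rewrite leNgt; apply/negP => /Fr; apply/negP; rewrite -leNgt.
  apply: le_trans (lagr_at_le Nk); apply: le_trans (lagr_at_ge (active k) Nk).
  by rewrite lerDl mulr_ge0 ?divr_ge0 ?dot_ge0 ?subr_ge0// ltW.
have zZ : enorm (z k) <= enorm Z.
  rewrite /enorm big_ord1 ler_wsqrtr// (bigD1 (active k))//=.
  under [X in _ <= X + _]eq_bigr do rewrite mxE.
  by rewrite lerDl; do 2![apply: sumr_ge0 => ? _]; exact: sqr_ge0.
have z0 : 0 <= enorm (z k) by exact: sqrtr_ge0.
by rewrite -enorm_sqr lerXn2r ?nnegrE// (le_trans _ ZN)// (le_trans z0).
Qed.

Lemma residual_sqr_bounded : exists B, forall k i, (N <= k)%N ->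
  dot (z k - row i (x k)) (z k - row i (x k)) <= B.
Proof.
have [m Fm] := F_bounded; exists ((lagr_at N - m) / ((rho - L) / 2)) => k i Nk.
rewrite ler_pdivlMr ?divr_gt0 ?subr_gt0// mulrC lerBrDl.
apply: le_trans (lagr_at_le Nk); apply: le_trans (lagr_at_ge i Nk).
by rewrite lerD2r; exact: (Fm _ (imageT _ _)).
Qed.

Lemma x_sqr_bounded : exists B, forall k i, (N <= k)%N ->
  dot (row i (x k)) (row i (x k)) <= B.
Proof.
have [Bz zB] := z_sqr_bounded; have [Br rB] := residual_sqr_bounded.
exists (2 * Bz + 2 * Br) => k i Nk.
have -> : row i (x k) = z k + - (z k - row i (x k)) by rewrite opprB addrC subrK.
apply: le_trans (dotD_le _ _) _; rewrite dotNl dotNr opprK.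
by rewrite lerD// ler_wpM2l// ?zB ?rB.
Qed.

(** After the first round [y] is a gradient, so it grows at most linearly in [x] around the value at
    0. *)
Lemma y_sqr_bounded i : exists B, forall k, (N <= k)%N ->
  dot (row i (y k)) (row i (y k)) <= B.
Proof.
have [Bx xB] := x_sqr_bounded.
exists (2 * (L ^+ 2 * Bx) + 2 * dot (grad (f i) 0) (grad (f i) 0)) => k Nk.
rewrite -visited_grad; last exact: leq_trans (ltn_ord i) Nk.
rewrite -[X in dot X X](subrK (grad (f i) 0)).
apply: le_trans (dotD_le _ _) _; rewrite lerD2r ler_wpM2l//.
apply: le_trans (grad_lip L_gt0 (f_smooth i) _ _) _.
by rewrite subr0 ler_wpM2l ?sqr_ge0// xB.
Qed.

(** * Vanishing increments and residuals *)

Lemma decrement_cvg0 : (fun k => lagr_at k - lagr_at k.+1) @ \oo --> (0 : R).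
Proof.
have [m lm] := lagr_at_bounded.
exact: cvg_decrement lagr_at_nonincreasing lm.
Qed.

Lemma dx_sqr_cvg0 i : (fun k => dot (row i (x k.+1) - row i (x k))
  (row i (x k.+1) - row i (x k))) @ \oo --> (0 : R).
Proof.
have D0 : (fun k => c^-1 * (lagr_at k - lagr_at k.+1)) @ \oo --> (0 : R).
  exact: cvgM_cst0 decrement_cvg0.
apply: (squeeze_cvgr _ (cvg_cst 0) D0).
exists N => // k /= Nk; rewrite dot_ge0 /= ler_pdivlMl//.
have := lagr_decrease i Nk.
rewrite lerBrDl; apply: le_trans.
by rewrite lerDl !mulr_ge0 ?dot_ge0 ?invr_ge0 ?ler0n ?ltW.
Qed.

Lemma dy_cvg0 i j : (fun k => y k.+1 i j - y k i j) @ \oo --> (0 : R).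
Proof.
apply: (cvg_sqr_le0 (cvgM_cst0 (L ^+ 2) (dx_sqr_cvg0 i))); exists N => // k /= Nk.
have := sqr_coord_le (row i (y k.+1) - row i (y k)) j; rewrite !mxE.
move=> /le_trans; apply; have iN := ltn_ord i.
rewrite -!visited_grad ?(leq_trans iN)// ?leqW//.
exact: (grad_lip L_gt0 (f_smooth i)).
Qed.

Lemma dz_cvg0 j : (fun k => z k.+1 0 j - z k 0 j) @ \oo --> (0 : R).
Proof.
have Nrho : 0 < N%:R * (rho / 2) by rewrite mulr_gt0 ?divr_gt0 ?ltr0n.
apply: (cvg_sqr_le0 (cvgM_cst0 (N%:R * (rho / 2))^-1 decrement_cvg0)); exists N => // k /= Nk.
have := sqr_coord_le (z k - z k.+1) j; rewrite !mxE -sqrrN opprB.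
move=> /le_trans; apply; rewrite ler_pdivlMl// -mulrA lerBrDl.
apply: le_trans (lagr_decrease (active k) Nk).
by rewrite lerD2r lerDl mulr_ge0 ?dot_ge0 ?ltW.
Qed.

Lemma residual_cvg0 i j : (fun k => z k 0 j - x k i j) @ \oo --> (0 : R).
Proof.
have rg : 0 < rho * g0 by rewrite mulr_gt0.
(* The first term is the drift of [z]. The second bounds the active agent's [z k - x k.+1], equal to
   its dual increment over [rho * gamma k], using [g0 <= gamma k]. *)
pose d : R^nat := fun k =>
  `|z k.+1 0 j - z k 0 j| + (rho * g0)^-1 * `|y k.+1 i j - y k i j|.
have d0 : d @ \oo --> (0 : R).
  have norm0 (u : R^nat) : u @ \oo --> (0 : R) -> (fun k => `|u k|) @ \oo --> (0 : R).
    by move=> /cvg_norm; rewrite normr0; exact.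
  have := cvgD (norm0 _ (dz_cvg0 j)) (cvgM_cst0 (rho * g0)^-1 (norm0 _ (dy_cvg0 i j))).
  by rewrite addr0; exact.
apply: norm_cvg0; apply: (cvg_periodic_reset (ltn_ord i) _ d0) => k //.
have -> : z k.+1 0 j - x k.+1 i j = (z k.+1 0 j - z k 0 j) + (z k 0 j - x k.+1 i j).
  by rewrite addrA subrK.
apply: le_trans (ler_normD _ _) _; rewrite -addrA lerD2l.
case: eqP => [ik|/nesym ik]; last first.
  have /rowP/(_ j) := x_idle iterates ik; rewrite !mxE => ->.
  by rewrite lerDr mulr_ge0// invr_ge0 ltW.
rewrite addr0 ler_pdivlMl//.
have /rowP/(_ j) := y_active iterates (esym ik); rewrite !mxE => ->.
rewrite [y k i j + _]addrC addrK normrM ger0_norm; last by rewrite mulr_ge0// ltW.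
by rewrite ler_wpM2r// ler_pM2l.
Qed.

(** * Existence of limit points and their KKT conditions *)

Lemma iterates_cluster : limit_points (fun k => (x k, y k, z k)) !=set0.
Proof.
have [|Kx cKx xK] := @rows_bounded_compact _ _ _ N x.
  by move=> i; have [B xB] := x_sqr_bounded; exists B => k; exact: xB.
have [Ky cKy yK] := rows_bounded_compact y_sqr_bounded.
have [|Kz cKz zK] := @rows_bounded_compact _ _ _ N z.
  move=> i; have [B zB] := z_sqr_bounded; exists B => k Nk.
  by rewrite (_ : row i (z k) = z k) ?zB//; apply/rowP => j; rewrite mxE ord1.
have cK := compact_setX (compact_setX cKx cKy) cKz.
have [|w [_ cw]] := cK ((fun k => (x k, y k, z k)) @ \oo) _; last by exists w.
by exists N => // k /= Nk; split; [split; [exact: xK|exact: yK]|exact: zK].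
Qed.

Lemma grad_coord_continuous i j : continuous (fun u => grad (f i) u 0 j).
Proof.
move=> v; apply: (@cvg_sqr_lipschitz _ _ _ (nbhs_filter v) _ v (L ^+ 2)) => [|u].
  exact: cvg_id.
have := sqr_coord_le (grad (f i) u - grad (f i) v) j; rewrite !mxE => /le_trans; apply.
exact: (grad_lip L_gt0 (f_smooth i)).
Qed.

(** Each KKT equation is, coordinate by coordinate, the vanishing at [w] of a continuous function
    that tends to 0 along the iterates. *)
Lemma cluster_KKT w : limit_points (fun k => (x k, y k, z k)) w -> KKT f w.
Proof.
move: w => [[x' y'] z'] cw.
pose T : Type := ('M[R]_(N, p) * 'M[R]_(N, p) * 'rV[R]_p)%type.
have c1 : continuous (fun w : T => w.1.1).
  move=> w; apply: (@continuous_comp _ _ _ (fun w : T => w.1) fst); exact: cvg_fst.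
have c2 : continuous (fun w : T => w.1.2).
  move=> w; apply: (@continuous_comp _ _ _ (fun w : T => w.1) snd).
    exact: cvg_fst.
  exact: cvg_snd.
have cx i j : continuous (fun w : T => w.1.1 i j).
  move=> w; apply: (@continuous_comp _ _ _ (fun w : T => w.1.1)
    (fun A : 'M[R]_(N, p) => A i j)); first exact: c1.
  exact: coord_continuous.
have cy i j : continuous (fun w : T => w.1.2 i j).
  move=> w; apply: (@continuous_comp _ _ _ (fun w : T => w.1.2)
    (fun A : 'M[R]_(N, p) => A i j)); first exact: c2.
  exact: coord_continuous.
have cz j : continuous (fun w : T => w.2 0 j).
  move=> w; apply: (@continuous_comp _ _ _ (fun w : T => w.2)
    (fun A : 'rV[R]_p => A 0 j)); first exact: cvg_snd.
  exact: coord_continuous.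
have cg i j : continuous (fun w : T => grad (f i) (row i w.1.1) 0 j).
  move=> w; apply: (@continuous_comp _ _ _ (fun w : T => row i w.1.1)
    (fun u => grad (f i) u 0 j)); last exact: grad_coord_continuous.
  apply: (@continuous_comp _ _ _ (fun w : T => w.1.1) (row i)); first exact: c1.
  exact: row_continuous.
have zx i : z' = row i x'.
  apply/rowP => j; rewrite mxE; apply: subr0_eq.
  apply: (@limit_points_cvg0 _ _ _ (fun w : T => w.2 0 j - w.1.1 i j) _ cw).
    by apply: continuousB; [exact: cz|exact: cx].
  exact: residual_cvg0.
split=> // [i|].
- apply/eqP; rewrite subr_eq0; apply/eqP/rowP => j.
  apply: subr0_eq; rewrite [row i y' 0 j]mxE.
  apply: (@limit_points_cvg0 _ _ _ (fun w : T => grad (f i) (row i w.1.1) 0 j - w.1.2 i j) _ cw).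
    by apply: continuousB; [exact: cg|exact: cy].
  (* From index [N] on, the stationarity residual is exactly zero. *)
  apply: cvg_near_cst; exists N => // k /= Nk.
  by rewrite visited_grad ?(leq_trans (ltn_ord i))// mxE subrr.
- apply/rowP => j; rewrite summxE mxE; under eq_bigr do rewrite mxE.
  apply: (@limit_points_cvg0 _ _ _ (fun w : T => \sum_i w.1.2 i j) _ cw).
    by apply: cvg_sumr => i; exact: cy.
  (* The invariant [consensus] turns the dual sum into [- rho] times the sum of the primal
     residuals. *)
  have -> : (fun w : 'M[R]_(N, p) * 'M[R]_(N, p) * 'rV[R]_p => \sum_i w.1.2 i j) \o
      (fun k => (x k, y k, z k)) = fun k => - rho * \sum_i (z k 0 j - x k i j).
    apply/funext => k /=.
    have zj : \sum_i (x k i j - rho^-1 * y k i j) = N%:R * z k 0 j.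
      have /rowP/(_ j) := consensus k; rewrite summxE [RHS]mxE => <-.
      by apply: eq_bigr => i _; rewrite !mxE.
    rewrite sumrB sumr_const card_ord -[z k 0 j *+ N]mulr_natl -zj sumrB.
    by rewrite addrAC subrr add0r -mulr_sumr mulrNN mulVKf// gt_eqF.
  apply: cvgM_cst0; apply: (@cvg_sumr0 _ _ _ _ _ (fun i k => z k 0 j - x k i j)) => i.
  exact: residual_cvg0.
Qed.

End Iterates.

Theorem theorem1 (R : realType) (N p : nat) (N_gt0 : (0 < N)%N)
  (e : rel 'I_N) (e_sym : symmetric e) (e_irr : irreflexive e)
  (e_connected : forall i j, connect e i j)
  (e_hamiltonian : cycle e (enum 'I_N))
  (f : 'I_N -> 'rV[R]_p -> R) (L : R) (L_gt0 : 0 < L)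
  (f_diff : forall i x, differentiable (f i : 'rV[R]_p -> R^o) x)
  (f_smooth : forall i u v,
     enorm (grad (f i) u - grad (f i) v) <= L * enorm (u - v))
  (F_bounded : has_lbound (range (separable_sum f)))
  (F_coercive : coercive (separable_sum f))
  (rho : R) (gamma : nat -> R)
  (x y : nat -> 'M[R]_(N, p)) (z : nat -> 'rV[R]_p)
  (iterates : PI_ADMM1 f rho gamma x y z)
  (rho_gtL : L < rho)
  (gamma_gt : forall k,
     Num.max ((2 * rho ^+ 2 + 4 * rho + 1) / (rho - L)) (2 * (rho + 2) * N%:R)
       < gamma k) :
  limit_points (fun k => (x k, y k, z k)) !=set0 /\
  limit_points (fun k => (x k, y k, z k)) `<=` [set w | KKT f w].
Proof.
(* The first entry of the maximum serves as uniform lower bound: [g0 * (rho - L)] is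
   [2 rho^2 + 4 rho + 1], which exceeds [4 L] because [L < rho]. *)
pose g0 := (2 * rho ^+ 2 + 4 * rho + 1) / (rho - L).
have rho_gt0 : 0 < rho by exact: lt_trans rho_gtL.
have rL : 0 < rho - L by rewrite subr_gt0.
have g0_gt0 : 0 < g0.
  by rewrite divr_gt0// !addr_gt0// mulr_gt0// exprn_gt0.
have g0_large : 4 * L < g0 * (rho - L).
  by rewrite divfK ?gt_eqF//; have := sqr_ge0 rho; lra.
have gamma_ge k : g0 <= gamma k.
  by have := gamma_gt k; rewrite gt_max => /andP[/ltW].
split; first exact: (iterates_cluster N_gt0 L_gt0 f_diff f_smooth F_bounded
  F_coercive iterates rho_gtL g0_gt0 g0_large gamma_ge).
move=> w; exact: (cluster_KKT N_gt0 L_gt0 f_diff f_smooth F_bounded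
  iterates rho_gtL g0_gt0 g0_large gamma_ge).
Qed.
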